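(* Let $\mathcal{R}$ be the achievable region of the $(n,k,d)=(4,3,3)$ exact-repair regenerating codes, i.e. the set of all normalized storage-bandwidth pairs $(\bar{\alpha},\bar{\beta})\in\mathbb{R}^2$ that are $(4,3,3)$ exact-repair achievable. Then $$\mathcal{R}=\left\{(\bar{\alpha},\bar{\beta})\in\mathbb{R}^2:\ 3\bar{\alpha}\geq 1,\quad 2\bar{\alpha}+\bar{\beta}\geq 1,\quad 4\bar{\alpha}+6\bar{\beta}\geq 3,\quad 6\bar{\beta}\geq 1\right\}.$$
   Context: For a positive integer $n$ write $I_n=\{1,2,\ldots,n\}$, and let $|A|$ denote the cardinality of a set $A$. **Code.** Let $N\ge 2$ and $K_d,K\ge 1$ be integers. An $(N,K_d,K)$ exact-repair regenerating code for the $(4,3,3)$ case consists of: - 4 encoding functions $f^E_i: I_N\to I_{K_d}$, $i\in I_4$ ($f^E_i(m)$ is the content of storage node $i$ when the message is $m$); - 4 decoding functions $f^D_A: I_{K_d}\times I_{K_d}\times I_{K_d}\to I_N$, one for each $A\subset I_4$ with $|A|=3$; - 12 repair encoding functions $F^E_{i,j}: I_{K_d}\to I_K$, for $j\in I_4$ and $i\in I_4\setminus\{j\}$ (helper node $i$ sends $F^E_{i,j}$ of its content to repair node $j$); - 4 repair decoding functions $F^D_j: I_K\times I_K\times I_K\to I_{K_d}$, $j\in I_4$; which satisfy both of the following (tuples indexed by a 3-element subset of $I_4$ are listed in increasing order of index): - (data reconstruction) $f^D_A\big((f^E_i(m))_{i\in A}\big)=m$ for all $m\in I_N$ and all $A\subset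 I_4$ with $|A|=3$; - (exact repair) $F^D_j\big((F^E_{i,j}(f^E_i(m)))_{i\in I_4\setminus\{j\}}\big)=f^E_j(m)$ for all $m\in I_N$ and all $j\in I_4$. **Achievability.** A pair $(\bar{\alpha},\bar{\beta})$ of real numbers is $(4,3,3)$ exact-repair achievable if for any $\epsilon>0$ there exists an $(N,K_d,K)$ exact-repair regenerating code (with $N,K_d,K$ allowed to depend on $\epsilon$) such that $$\bar{\alpha}+\epsilon\geq\frac{\log K_d}{\log N},\qquad \bar{\beta}+\epsilon\geq\frac{\log K}{\log N}.$$ The achievable region $\mathcal{R}$ is the collection of all achievable pairs $(\bar{\alpha},\bar{\beta})$. *)

(* Defs.v *)
From HB Require Import structures.
From mathcomp Require Import all_boot all_order all_algebra.
From mathcomp Require Import all_classical all_reals all_analysis.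

Set Implicit Arguments.
Unset Strict Implicit.
Unset Printing Implicit Defensive.

Import Order.TTheory GRing.Theory Num.Theory.
Local Open Scope classical_set_scope.
Local Open Scope ring_scope.

(* Nodes, messages and symbols are numbered from 0: 'I_n stands for {1,...,n}. *)

Definition node_triple : Type := {A : {set 'I_4} | #|A| == 3%N}.

Lemma size_node_triple (A : node_triple) : size (enum (val A)) == 3%N.
Proof. by rewrite -cardE (valP A). Qed.

(* [enum] follows the enumeration 0, 1, 2, 3 of 'I_4, hence is increasing. *)
Definition node_list (A : node_triple) : 3.-tuple 'I_4 :=
  Tuple (size_node_triple A).

Lemma card_helpers (j : 'I_4) : #|[set~ j]%SET| == 3%N.
Proof. by rewrite cardsC1 card_ord. Qed.

Definition helpers (j : 'I_4) : node_triple := Sub [set~ j]%SET (card_helpers j).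

(* The values [repair_encode i i] of the repair encoding functions are never
   used: only the 12 functions with i <> j take part in a code. *)
Record regenerating_code (N Kd K : nat) := RegeneratingCode {
  encode : 'I_4 -> 'I_N -> 'I_Kd;
  decode : node_triple -> 3.-tuple 'I_Kd -> 'I_N;
  repair_encode : 'I_4 -> 'I_4 -> 'I_Kd -> 'I_K;
  repair_decode : 'I_4 -> 3.-tuple 'I_K -> 'I_Kd;
  data_reconstruction : forall (m : 'I_N) (A : node_triple),
    decode A [tuple of [seq encode i m | i <- node_list A]] = m;
  exact_repair : forall (m : 'I_N) (j : 'I_4),
    repair_decode j
      [tuple of [seq repair_encode i j (encode i m) | i <- node_list (helpers j)]]
    = encode j m
}.

Definition achievable (R : realType) (alpha beta : R) : Prop :=
  forall eps : R, 0 < eps ->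
  exists (N Kd K : nat) (_ : regenerating_code N Kd K),
    [/\ (2 <= N)%N, (1 <= Kd)%N, (1 <= K)%N,
        alpha + eps >= ln (Kd%:R : R) / ln (N%:R : R) &
        beta + eps >= ln (K%:R : R) / ln (N%:R : R)].

Definition achievable_region (R : realType) : set (R * R) :=
  [set p | achievable p.1 p.2].
Arguments achievable_region R : clear implicits.

(* Main.v *)
Require Import Defs.
From HB Require Import structures.
From mathcomp Require Import all_boot all_order all_algebra.
From mathcomp Require Import all_classical all_reals all_analysis.
From mathcomp Require Import zify ring lra.

(** Let the message be uniform, so that storage contents [W_i] and helper
    messages [S_ij] become random variables, and let [B] be the entropy of the
    message. Three of the four bounds are cut-set bounds. For
    [3 B <= 4 alpha + 6 beta], number the nodes from 0: [W_0] is a function of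
    [X = (W_1, S_20, S_30)] and [W_1] is a function of [Y = (W_0, S_21, S_31)],
    so submodularity gives [H(X, Y) + H(W_0, W_1) <= H(X) + H(Y)], which is at
    most [2 alpha + 4 beta]. Here [B <= H(W_0, W_1) + beta]; since
    [Q = (S_20, S_21)] is a function both of [(X, Y)] and of [W_2], also
    [B + H(Q) <= H(X, Y) + alpha]; and finally [B <= H(Q) + H(W_3) + H(S_10)].

    The corner points are [(1/3, 1/3)], [(3/8, 1/4)] and [(1/2, 1/6)]. They are
    attained by binary codes with a single-parity block on each 4-, 3- or
    2-element set of nodes respectively; products of powers of these codes fill
    the segments in between. *)

Set Implicit Arguments.
Unset Strict Implicit.
Unset Printing Implicit Defensive.

Import Order.TTheory GRing.Theory Num.Theory.
Local Open Scope classical_set_scope.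
Local Open Scope ring_scope.

(** * Entropy of a function of a uniform random variable *)

Definition fiber_card (T : finType) (V : eqType) (f : T -> V) (x : T) : nat :=
  #|[pred y | f y == f x]|.

(** Shannon entropy in nats of [f] at a uniform point, averaged over [T] so that no sum over values
    in [V] occurs. *)
Definition entropy (R : realType) (T : finType) (V : eqType) (f : T -> V) : R :=
  (\sum_x ln (#|T|%:R / (fiber_card f x)%:R)) / #|T|%:R.

Definition pairf (T V W : Type) (f : T -> V) (g : T -> W) (x : T) : V * W :=
  (f x, g x).

Lemma fiber_card_gt0 (T : finType) (V : eqType) (f : T -> V) (x : T) :
  (0 < fiber_card f x)%N.
Proof. by apply/card_gt0P; exists x; rewrite inE /=. Qed.

Lemma ler_ln_subr1 (R : realType) (x : R) : 0 < x -> ln x <= x - 1.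
Proof. by move=> x0; rewrite -{1}(subrK 1 x) addrC; apply: le_ln1Dx; lra. Qed.

(** Jensen's inequality through [ln w <= w - 1]: the common source of submodularity and of the
    alphabet bound. *)
Lemma sum_ln_le0 (R : realType) (T : finType) (w : T -> R) :
  (forall x, 0 < w x) -> \sum_x w x <= #|T|%:R -> \sum_x ln (w x) <= 0.
Proof.
move=> w0 sw; apply: (@le_trans _ _ (\sum_x (w x - 1))).
  by apply: ler_sum => x _; apply: ler_ln_subr1.
by rewrite sumrB sumr_const subr_le0.
Qed.

Lemma sum_fiber_inv_le (R : realType) (T : finType) (V : eqType) (f : T -> V)
    (P : pred T) (v : V) : (forall x, P x -> f x = v) ->
  \sum_(x | P x) (fiber_card f x)%:R^-1 <= 1 :> R.
Proof.
move=> Pv; case: (pickP P) => [x0 Px0|P0]; last by rewrite big_pred0.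
have -> : \sum_(x | P x) (fiber_card f x)%:R^-1 =
          \sum_(x | P x) (fiber_card f x0)%:R^-1 :> R.
  by apply: eq_bigr => x Px; rewrite /fiber_card (Pv _ Px) (Pv _ Px0).
rewrite sumr_const -[leLHS]mulr_natl ler_pdivrMr ?ltr0n ?fiber_card_gt0//.
rewrite mul1r ler_nat; apply/subset_leq_card/fintype.subsetP => x Px.
by rewrite inE/= (Pv _ Px) (Pv _ Px0).
Qed.

(* Count the triples [(a, b, x)] with [f a = f x] and [g b = g x], each with weight
   [c x * d x]: for fixed [a] and [b] such [x] lie in one fiber of [pairf f g],
   and exist only if [k a = k b]. *)
Lemma sum_fiber_ratio_le (R : realType) (T : finType) (V W Z : eqType)
    (f : T -> V) (g : T -> W) (k : T -> Z) :
  (forall x y, f x = f y -> k x = k y) ->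
  (forall x y, g x = g y -> k x = k y) ->
  \sum_x ((fiber_card f x)%:R * (fiber_card g x)%:R /
    ((fiber_card (pairf f g) x)%:R * (fiber_card k x)%:R)) <= #|T|%:R :> R.
Proof.
move=> fk gk; pose c x : R := (fiber_card (pairf f g) x)%:R^-1.
pose d x : R := (fiber_card k x)%:R^-1.
have -> : \sum_x ((fiber_card f x)%:R * (fiber_card g x)%:R /
    ((fiber_card (pairf f g) x)%:R * (fiber_card k x)%:R)) =
  \sum_a \sum_b \sum_(x | (f a == f x) && (g b == g x)) c x * d x :> R.
  transitivity (\sum_x \sum_a \sum_b
      if (f a == f x) && (g b == g x) then c x * d x else 0).
    apply: eq_bigr => x _.
    transitivity (\sum_(a | f a == f x) \sum_(b | g b == g x) c x * d x).
      rewrite !sumr_const -mulrnA -[RHS]mulr_natl natrM invfM /c /d.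
      by congr (_ * _); apply: mulrC.
    rewrite [LHS]big_mkcond; apply: eq_bigr => a _.
    by case: (f a == f x); [exact: big_mkcond|rewrite big1].
  rewrite exchange_big; apply: eq_bigr => a _.
  by rewrite exchange_big; apply: eq_bigr => b _; rewrite [RHS]big_mkcond.
rewrite -sum1_card natr_sum; apply: ler_sum => a _.
(* For fixed [a], only [b] in the [k]-fiber of [a] contribute, each at most [d a], the inverse size
   of that fiber. *)
apply: (@le_trans _ _ (\sum_(b | k b == k a) d a)); last first.
  rewrite sumr_const -[leLHS]mulr_natl /d divff//.
  by rewrite pnatr_eq0 -lt0n fiber_card_gt0.
rewrite [leRHS]big_mkcond; apply: ler_sum => b _.
have [kab|kab] := eqVneq (k b) (k a).
  rewrite (_ : \sum_(_ | _) _ = (\sum_(x | (f a == f x) && (g b == g x)) c x) * d a).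
    rewrite -[leRHS]mul1r ler_wpM2r ?invr_ge0 ?ler0n//.
    apply: (@sum_fiber_inv_le _ _ _ _ _ (f a, g b)).
    by move=> x /andP[/eqP e1 /eqP e2]; rewrite /pairf e1 e2.
  rewrite mulr_suml; apply: eq_bigr => x /andP[/eqP /fk e _].
  by rewrite /d /fiber_card e.
rewrite big_pred0// => x; apply/negbTE/negP => /andP[/eqP /fk e1 /eqP /gk e2].
by rewrite e1 e2 eqxx in kab.
Qed.

(** Left side minus right side is the average logarithm of the ratios in [sum_fiber_ratio_le]. *)
Lemma entropy_submodular (R : realType) (T : finType) (V W Z : eqType)
    (f : T -> V) (g : T -> W) (k : T -> Z) :
  (forall x y, f x = f y -> k x = k y) ->
  (forall x y, g x = g y -> k x = k y) ->
  entropy R (pairf f g) + entropy R k <= entropy R f + entropy R g.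
Proof.
move=> fk gk; rewrite /entropy -!mulrDl ler_wpM2r ?invr_ge0 ?ler0n//.
rewrite -subr_le0 -!big_split/= -sumrB.
have pos (U : eqType) (h : T -> U) x : 0 < (fiber_card h x)%:R :> R.
  by rewrite ltr0n fiber_card_gt0.
have Tpos (x : T) : 0 < #|T|%:R :> R.
  by rewrite ltr0n; apply/card_gt0P; exists x.
rewrite (eq_bigr (fun x => ln ((fiber_card f x)%:R * (fiber_card g x)%:R /
    ((fiber_card (pairf f g) x)%:R * (fiber_card k x)%:R)))).
  apply: sum_ln_le0 => [x|]; last exact: sum_fiber_ratio_le.
  by rewrite divr_gt0 ?mulr_gt0.
move=> x _; rewrite !(ln_div, lnM) ?posrE ?mulr_gt0//; try exact: Tpos.
ring.
Qed.

Lemma entropy_mono (R : realType) (T : finType) (V W : eqType)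
    (f : T -> V) (g : T -> W) :
  (forall x y, f x = f y -> g x = g y) -> entropy R g <= entropy R f.
Proof.
move=> fg; rewrite /entropy ler_wpM2r ?invr_ge0 ?ler0n//.
apply: ler_sum => x _.
have Tpos : (0 < #|T|)%N by apply/card_gt0P; exists x.
rewrite ler_ln ?posrE ?divr_gt0 ?ltr0n ?fiber_card_gt0//.
rewrite ler_pM2l ?ltr0n// lef_pV2 ?posrE ?ltr0n ?fiber_card_gt0// ler_nat.
by apply/subset_leq_card/fintype.subsetP => y; rewrite !inE/= => /eqP/fg ->.
Qed.

(** Submodularity with a constant, of entropy zero, as the common function. *)
Lemma entropy_pair_le (R : realType) (T : finType) (V W : eqType)
    (f : T -> V) (g : T -> W) :
  entropy R (pairf f g) <= entropy R f + entropy R g.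
Proof.
have := @entropy_submodular R T V W unit f g (fun=> tt) (fun _ _ _ => erefl)
  (fun _ _ _ => erefl).
suff -> : entropy R (fun _ : T => tt) = 0 by rewrite addr0.
rewrite /entropy big1 ?mul0r// => x _.
have -> : fiber_card (fun _ : T => tt) x = #|T|.
  by rewrite /fiber_card; apply: eq_card => y; rewrite !inE.
rewrite divff ?ln1// pnatr_eq0 -lt0n; by apply/card_gt0P; exists x.
Qed.

Lemma entropy_inj (R : realType) (T : finType) (V : eqType) (f : T -> V) :
  (0 < #|T|)%N -> injective f -> entropy R f = ln #|T|%:R.
Proof.
move=> T0 fi; rewrite /entropy (eq_bigr (fun=> ln #|T|%:R)) => [|x _].
  by rewrite sumr_const -[X in X / _]mulr_natl mulrAC divff ?mul1r// pnatr_eq0 -lt0n.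
rewrite (_ : fiber_card f x = 1%N) ?divr1// /fiber_card -(card1 x).
by apply: eq_card => y; rewrite !inE (inj_eq fi).
Qed.

(** Each of the [#|V|] possible fibers adds at most 1 to the sum of inverse fiber sizes, so
    [sum_ln_le0] applies to [1 / #|V|] over the probability of [f x]. *)
Lemma entropy_le_ln_card (R : realType) (T V : finType) (f : T -> V) :
  (0 < #|T|)%N -> entropy R f <= ln #|V|%:R.
Proof.
move=> T0; have Tp : 0 < #|T|%:R :> R by rewrite ltr0n.
have Vp : 0 < #|V|%:R :> R.
  by case/card_gt0P: T0 => x _; rewrite ltr0n; apply/card_gt0P; exists (f x).
have pos x : 0 < (fiber_card f x)%:R :> R by rewrite ltr0n fiber_card_gt0.
rewrite /entropy ler_pdivrMr// -subr_le0.
have -> : ln #|V|%:R * #|T|%:R = \sum_(x : T) ln #|V|%:R :> R.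
  by rewrite sumr_const mulr_natr.
rewrite -sumrB.
rewrite (eq_bigr (fun x => ln (#|T|%:R / #|V|%:R * (fiber_card f x)%:R^-1))).
  apply: sum_ln_le0 => [x|]; first by rewrite mulr_gt0 ?divr_gt0 ?invr_gt0.
  rewrite -mulr_sumr -mulrA ler_piMr ?ler0n// mulrC ler_pdivrMr// mul1r.
  rewrite (partition_big f xpredT)//= (_ : #|V|%:R = \sum_(v : V) 1); last by rewrite sumr_const.
  by apply: ler_sum => v _; apply: (@sum_fiber_inv_le _ _ _ _ _ v) => x /eqP.
move=> x _; rewrite !ln_div ?posrE ?divr_gt0//.
ring.
Qed.

(** * Outer bounds *)

Definition sent (M D S : Type) (e : 'I_4 -> M -> D) (r : 'I_4 -> 'I_4 -> D -> S)
    (i j : 'I_4) (m : M) : S := r i j (e i m).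

(* The existence of decoding functions is replaced by injectivity conditions. *)
Definition scheme (M D S : Type) (e : 'I_4 -> M -> D)
    (r : 'I_4 -> 'I_4 -> D -> S) : Prop :=
  (forall j m m', (forall i, i != j -> e i m = e i m') -> m = m') /\
  (forall j m m', (forall i, i != j -> sent e r i j m = sent e r i j m') ->
     e j m = e j m').

Lemma map_helpers_eq (V : eqType) (f g : 'I_4 -> V) (j : 'I_4) :
  (forall i, i != j -> f i = g i) ->
  [tuple of [seq f i | i <- node_list (helpers j)]] =
  [tuple of [seq g i | i <- node_list (helpers j)]].
Proof.
move=> fg; apply: val_inj => /=; apply/eq_in_map => i.
by rewrite mem_enum in_setC1 => /fg.
Qed.

Lemma code_scheme (N Kd K : nat) (c : regenerating_code N Kd K) :
  scheme (encode c) (repair_encode c).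
Proof.
split=> j m m' h.
  rewrite -(data_reconstruction c m (helpers j)).
  rewrite -(data_reconstruction c m' (helpers j)).
  by congr (Defs.decode c _ _); apply: map_helpers_eq.
rewrite -(exact_repair c m j) -(exact_repair c m' j).
by congr (repair_decode c _ _); apply: map_helpers_eq.
Qed.

Lemma ord4_eq_or (a b c d i : 'I_4) : uniq [:: a; b; c; d] -> i != d ->
  [\/ i = a, i = b | i = c].
Proof.
rewrite /= !inE !negb_or -!val_eqE /= => abcd id.
have : [|| val i == val a, val i == val b | val i == val c].
  have := ltn_ord a; have := ltn_ord b; have := ltn_ord c.
  have := ltn_ord d; have := ltn_ord i; move: abcd id => /=; lia.
by case/or3P => /eqP/val_inj ->; [apply: Or31|apply: Or32|apply: Or33].
Qed.

Section Converse.
Variables (R : realType) (M D S : finType).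
Variables (e : 'I_4 -> M -> D) (r : 'I_4 -> 'I_4 -> D -> S).
Hypotheses (er : scheme e r) (M0 : (0 < #|M|)%N).
Local Notation H := (entropy R).
Local Notation s := (sent e r).

Lemma nodes3_inj (a b c d : 'I_4) (m m' : M) : uniq [:: a; b; c; d] ->
  e a m = e a m' -> e b m = e b m' -> e c m = e c m' -> m = m'.
Proof.
move=> abcd ea eb ec; apply: (er.1 d) => i.
by case/(ord4_eq_or abcd) => ->.
Qed.

Lemma sent_repair (a b c d : 'I_4) (m m' : M) : uniq [:: a; b; c; d] ->
  s a d m = s a d m' -> s b d m = s b d m' -> s c d m = s c d m' ->
  e d m = e d m'.
Proof.
move=> abcd ea eb ec; apply: (er.2 d) => i.
by case/(ord4_eq_or abcd) => ->.
Qed.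

Lemma sent_eq (i j : 'I_4) (m m' : M) : e i m = e i m' -> s i j m = s i j m'.
Proof. by rewrite /sent => ->. Qed.

Lemma entropy_node_le i : H (e i) <= ln #|D|%:R.
Proof. exact: (entropy_le_ln_card R (e i) M0). Qed.

Lemma entropy_sent_le i j : H (s i j) <= ln #|S|%:R.
Proof. exact: (entropy_le_ln_card R (s i j) M0). Qed.

Lemma scheme_bound3 : ln #|M|%:R <= 3 * ln #|D|%:R :> R.
Proof.
have inj : injective (pairf (e 0) (pairf (e 1) (e 2))).
  by move=> x y [e0 e1 e2]; apply: (@nodes3_inj 0 1 2 3).
have := entropy_inj R M0 inj.
have := entropy_pair_le R (e 0) (pairf (e 1) (e 2)).
have := entropy_pair_le R (e 1) (e 2).
have := entropy_node_le 0; have := entropy_node_le 1; have := entropy_node_le 2.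
lra.
Qed.

Lemma two_nodes_sent_inj : injective (pairf (pairf (e 0) (e 1)) (s 3 2)).
Proof.
move=> x y [e0 e1 s32].
apply: (@nodes3_inj 0 1 2 3) => //.
by apply: (@sent_repair 0 1 3 2) => //; apply: sent_eq.
Qed.

Lemma scheme_bound21 : ln #|M|%:R <= 2 * ln #|D|%:R + ln #|S|%:R :> R.
Proof.
have := entropy_inj R M0 two_nodes_sent_inj.
have := entropy_pair_le R (pairf (e 0) (e 1)) (s 3 2).
have := entropy_pair_le R (e 0) (e 1).
have := entropy_node_le 0; have := entropy_node_le 1.
have := entropy_sent_le 3 2; lra.
Qed.

(** Successive repair: three symbols rebuild node 0, which then supplies its own, so two more
    rebuild node 1 and one more node 2. *)
Lemma scheme_bound6 : ln #|M|%:R <= 6 * ln #|S|%:R :> R.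
Proof.
have inj : injective (pairf (pairf (s 1 0) (pairf (s 2 0) (s 3 0)))
                     (pairf (pairf (s 2 1) (s 3 1)) (s 3 2))).
  move=> x y [s10 s20 s30 s21 s31 s32].
  have e0 : e 0 x = e 0 y by apply: (@sent_repair 1 2 3 0).
  have e1 : e 1 x = e 1 y by apply: (@sent_repair 0 2 3 1) => //; apply: sent_eq.
  by apply: two_nodes_sent_inj; rewrite /pairf e0 e1 s32.
have := entropy_inj R M0 inj.
have := entropy_pair_le R (pairf (s 1 0) (pairf (s 2 0) (s 3 0)))
                     (pairf (pairf (s 2 1) (s 3 1)) (s 3 2)).
have := entropy_pair_le R (s 1 0) (pairf (s 2 0) (s 3 0)).
have := entropy_pair_le R (s 2 0) (s 3 0).
have := entropy_pair_le R (pairf (s 2 1) (s 3 1)) (s 3 2).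
have := entropy_pair_le R (s 2 1) (s 3 1).
have := entropy_sent_le 1 0; have := entropy_sent_le 2 0.
have := entropy_sent_le 3 0; have := entropy_sent_le 2 1.
have := entropy_sent_le 3 1; have := entropy_sent_le 3 2.
lra.
Qed.

Lemma scheme_bound46 :
  3 * ln #|M|%:R <= 4 * ln #|D|%:R + 6 * ln #|S|%:R :> R.
Proof.
pose X := pairf (e 1) (pairf (s 2 0) (s 3 0)).
pose Y := pairf (e 0) (pairf (s 2 1) (s 3 1)).
pose Q := pairf (s 2 0) (s 2 1).
have XV x y : X x = X y -> pairf (e 0) (e 1) x = pairf (e 0) (e 1) y.
  move=> [e1 s20 s30]; congr pair => //.
  by apply: (@sent_repair 1 2 3 0) => //; apply: sent_eq.
have YV x y : Y x = Y y -> pairf (e 0) (e 1) x = pairf (e 0) (e 1) y.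
  move=> [e0 s21 s31]; congr pair => //.
  by apply: (@sent_repair 0 2 3 1) => //; apply: sent_eq.
have XYQ x y : pairf X Y x = pairf X Y y -> Q x = Q y.
  move=> [_ s20 _ _ s21 _].
  by rewrite /Q /pairf s20 s21.
have WQ x y : e 2 x = e 2 y -> Q x = Q y.
  by move=> e2; congr pair; apply: sent_eq.
have inj1 : injective (pairf (pairf X Y) (e 2)).
  move=> x y [e1 _ _ e0 _ _ e2].
  by apply: (@nodes3_inj 0 1 2 3).
(* Node 3 adds [s 3 0], which repairs node 0; nodes 0 and 3 then add [s 0 1] and [s 3 1], which
   repairs node 1. *)
have inj2 : injective (pairf Q (pairf (e 3) (s 1 0))).
  move=> x y [s20 s21 e3 s10].
  have e0 : e 0 x = e 0 y by apply: (@sent_repair 1 2 3 0) => //; apply: sent_eq.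
  have e1 : e 1 x = e 1 y by apply: (@sent_repair 0 2 3 1) => //; apply: sent_eq.
  by apply: (@nodes3_inj 0 1 3 2).
have := entropy_submodular R XV YV.
have := entropy_pair_le R (e 1) (pairf (s 2 0) (s 3 0)).
have := entropy_pair_le R (s 2 0) (s 3 0).
have := entropy_pair_le R (e 0) (pairf (s 2 1) (s 3 1)).
have := entropy_pair_le R (s 2 1) (s 3 1).
have := entropy_inj R M0 two_nodes_sent_inj.
have := entropy_pair_le R (pairf (e 0) (e 1)) (s 3 2).
have := entropy_submodular R XYQ WQ.
have := entropy_inj R M0 inj1.
have := entropy_inj R M0 inj2.
have := entropy_pair_le R Q (pairf (e 3) (s 1 0)).
have := entropy_pair_le R (e 3) (s 1 0).
have := entropy_node_le 0; have := entropy_node_le 1.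
have := entropy_node_le 2; have := entropy_node_le 3.
have := entropy_sent_le 2 0; have := entropy_sent_le 3 0.
have := entropy_sent_le 2 1; have := entropy_sent_le 3 1.
have := entropy_sent_le 3 2; have := entropy_sent_le 1 0.
rewrite -/X -/Y; lra.
Qed.

End Converse.

(** Dividing by [ln N] and letting the slack tend to zero carries a linear bound from codes to
    achievable pairs. *)
Lemma achievable_bound (R : realType) (alpha beta : R) (u v w : nat) :
  achievable alpha beta ->
  (forall N Kd K (c : regenerating_code N Kd K), (0 < N)%N ->
     u%:R * ln N%:R <= v%:R * ln Kd%:R + w%:R * ln K%:R :> R) ->
  u%:R <= v%:R * alpha + w%:R * beta.
Proof.
move=> ach h; apply/ler_addgt0Pr => eps eps0.
(* The slack [eps / t] gets multiplied by [v + w]; the successor keeps [t] positive. *)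
pose t : R := (v + w).+1%:R.
have t0 : 0 < t by rewrite ltr0n.
have [N [Kd [K [c [N2 _ _ hA hB]]]]] := ach (eps / t) (divr_gt0 eps0 t0).
have lN : 0 < ln N%:R :> R by rewrite ln_gt0// ltr1n.
have {h} := h _ _ _ c (ltnW N2).
rewrite ler_pdivrMr// in hA; rewrite ler_pdivrMr// in hB.
have := ler_wpM2l (ler0n R v) hA; have := ler_wpM2l (ler0n R w) hB.
move=> h1 h2 h3.
rewrite -(ler_pM2r lN).
have e1 : (v + w)%:R * (eps / t) <= eps.
  by rewrite mulrCA ler_piMr ?(ltW eps0)// ler_pdivrMr// mul1r ler_nat.
have := ler_wpM2r (ltW lN) e1; rewrite natrD.
move: (eps / t) (ln _) lN h1 h2 h3 => d L lN h1 h2 h3 h4; nra.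
Qed.

(** * Binary codes *)

(** The decoders search for a message consistent with the symbols received. A repair decoder may
    find a wrong message, but one with the same content of node [j]. *)
Lemma scheme_code (M D S : finType) (e : 'I_4 -> M -> D)
    (r : 'I_4 -> 'I_4 -> D -> S) : (0 < #|M|)%N -> scheme e r ->
  inhabited (regenerating_code #|M| #|D| #|S|).
Proof.
case/card_gt0P => m0 _ [rec rep].
pose E i (m : 'I_#|M|) : 'I_#|D| := enum_rank (e i (enum_val m)).
pose F i j (d : 'I_#|D|) : 'I_#|S| := enum_rank (r i j (enum_val d)).
pose dec (A : node_triple) t := odflt (enum_rank m0)
  [pick m | [tuple of [seq E i m | i <- node_list A]] == t].
pose rdec j t := E j (odflt (enum_rank m0)
  [pick m | [tuple of [seq F i j (E i m) | i <- node_list (helpers j)]] == t]).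
exists; apply: (@RegeneratingCode _ _ _ E dec F rdec) => [m A|m j].
  rewrite /dec; case: pickP => [m' /eqP h|/(_ m)]; last by rewrite eqxx.
  (* A triple is the complement of one node, the index used by [scheme]. *)
  have [j Aj] : exists j, val A = [set~ j]%SET.
    have /cards1P[j Aj] : #|~: val A| == 1%N.
      by rewrite -(eqn_add2l #|val A|) cardsC card_ord (eqP (valP A)).
    by exists j; rewrite -Aj finset.setCK.
  apply: enum_val_inj; apply: (rec j) => i ij /=.
  have /eq_in_map/(_ i) := congr1 val h.
  by rewrite mem_enum Aj in_setC1 => /(_ ij) /enum_rank_inj.
rewrite /rdec; case: pickP => [m' /eqP h|/(_ m)]; last by rewrite eqxx.
congr enum_rank; apply: (rep j) => i ij /=.
have /eq_in_map/(_ i) := congr1 val h.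
rewrite mem_enum in_setC1 => /(_ ij) /enum_rank_inj.
by rewrite !enum_rankK.
Qed.

(** With powers of two, products add exponents and the ratios of logarithms are [a / B] and
    [b / B]. *)
Definition binary_scheme (B a b : nat) : Prop :=
  exists (M D S : finType) (e : 'I_4 -> M -> D) (r : 'I_4 -> 'I_4 -> D -> S),
    [/\ #|M| = (2 ^ B)%N, #|D| = (2 ^ a)%N, #|S| = (2 ^ b)%N & scheme e r].

Lemma binary_scheme0 : binary_scheme 0 0 0.
Proof.
exists unit, unit, unit, (fun _ _ => tt), (fun _ _ _ => tt).
by split; rewrite ?card_unit//; split=> // j [] [].
Qed.

Lemma binary_schemeD (B a b B' a' b' : nat) :
  binary_scheme B a b -> binary_scheme B' a' b' ->
  binary_scheme (B + B') (a + a') (b + b').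
Proof.
move=> [M [D [S [e [r [cM cD cS [h1 h2]]]]]]].
move=> [M' [D' [S' [e' [r' [cM' cD' cS' [h1' h2']]]]]]].
exists (M * M')%type, (D * D')%type, (S * S')%type.
exists (fun i m => (e i m.1, e' i m.2)).
exists (fun i j d => (r i j d.1, r' i j d.2)).
rewrite !card_prod cM cM' cD cD' cS cS' -!expnD; split=> //.
split=> j [m n] [m' n'] h.
  by congr pair; [apply: (h1 j)|apply: (h1' j)] => i /h[].
by congr pair; [apply: (h2 j)|apply: (h2' j)] => i /h[].
Qed.

Lemma binary_schemeM (B a b k : nat) :
  binary_scheme B a b -> binary_scheme (k * B) (k * a) (k * b).
Proof.
move=> h; elim: k => [|k ih]; first exact: binary_scheme0.
by rewrite !mulSn; apply: binary_schemeD.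
Qed.

(* Specializes the agreement hypothesis [h] to the three nodes other than [j] and
   eliminates the resulting equations between sums of bits. *)
Ltac solve_agreement h j :=
  move: (h 0) (h 1) (h 2) (h 3); clear h;
  case: j => -[|[|[|[|//]]]] j /= h0 h1 h2 h3;
  repeat match goal with H : is_true _ -> _ |- _ =>
    first [case: (H isT) => *; clear H | clear H] end;
  subst;
  repeat match goal with H : _ (+) _ = _ |- _ =>
    first [apply addbI in H | apply addIb in H]; subst end;
  by [].

(** Any three bits of the parity code determine the message, and a helper sends its whole
    content. *)
Lemma msr_scheme : binary_scheme 3 1 1.
Proof.
pose e (i : 'I_4) (m : bool * bool * bool) : bool :=
  let: (x, y, z) := m in
  match val i with 0 => x | 1 => y | 2 => z | _ => x (+) y (+) z end.
exists (bool * bool * bool)%type, bool, bool, e, (fun _ _ d => d).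
rewrite !card_prod card_bool; split=> //.
have h j m m' : (forall i, i != j -> e i m = e i m') -> m = m'.
  by case: m m' => [[x y] z] [[x' y'] z'] h; solve_agreement h j.
by split=> // j m m' /h ->.
Qed.

(* Each bit [x_kl] is stored on the two nodes [k] and [l]; node [i] sends to [j] the
   bit they share, which has index [unbump i j] in the content of [i]. *)
Lemma mbr_scheme : binary_scheme 6 3 1.
Proof.
pose e (i : 'I_4) (m : bool * bool * bool * (bool * bool * bool)) :=
  let: ((x01, x02, x03), (x12, x13, x23)) := m in
  match val i with
  | 0 => (x01, x02, x03) | 1 => (x01, x12, x13)
  | 2 => (x02, x12, x23) | _ => (x03, x13, x23) end.
pose r (i j : 'I_4) (d : bool * bool * bool) :=
  let: (x, y, z) := d in
  match unbump i j with 0 => x | 1 => y | _ => z end.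
exists (bool * bool * bool * (bool * bool * bool))%type.
exists (bool * bool * bool)%type, bool, e, r.
rewrite !card_prod card_bool; split=> //.
by split=> j [[[x y] z] [[u v] w]] [[[x' y'] z'] [[u' v'] w']] h;
  rewrite /sent /= in h; solve_agreement h j.
Qed.

(* The parity blocks on {1,2,3}, {0,2,3}, {0,1,3}, {0,1,2} carry the bits
   [(a, b)], [(c, d)], [(u, v)], [(g, h)]. Node [i] stores its symbols in the order
   of the omitted node, so a helper for [j] skips coordinate [unbump i j]. *)
Lemma layered_scheme : binary_scheme 8 3 2.
Proof.
pose block : finType := (bool * bool)%type.
pose e (i : 'I_4) (m : block * block * (block * block)) :=
  let: (((a, b), (c, d)), ((u, v), (g, h))) := m in
  match val i with
  | 0 => (c, u, g) | 1 => (a, v, h)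
  | 2 => (b, d, g (+) h) | _ => (a (+) b, c (+) d, u (+) v) end.
pose r (i j : 'I_4) (d : bool * bool * bool) :=
  let: (x, y, z) := d in
  match unbump i j with 0 => (y, z) | 1 => (x, z) | _ => (x, y) end.
exists (block * block * (block * block))%type.
exists (bool * bool * bool)%type, block, e, r.
rewrite !card_prod card_bool; split=> //.
by split=> j [[[a b] [c d]] [[u v] [g k]]] [[[a' b'] [c' d']] [[u' v'] [g' k']]] h;
  rewrite /sent /= in h; solve_agreement h j.
Qed.

(** * The achievable region *)

Lemma binary_scheme_code (B a b : nat) : binary_scheme B a b ->
  inhabited (regenerating_code (2 ^ B) (2 ^ a) (2 ^ b)).
Proof.
move=> [M [D [S [e [r [cM cD cS h]]]]]]; rewrite -cM -cD -cS.
by apply: scheme_code h; rewrite cM expn_gt0.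
Qed.

(** Here [p] is [t * n] rounded down: rounding adds at most one copy of cost [y], covered by
    [n * eps]. *)
Lemma mix_le (R : realType) (B x y p n : nat) (t eps : R) :
  (0 < B)%N -> (0 < n)%N -> (p <= n)%N -> p%:R <= t * n%:R ->
  t * n%:R <= p%:R + 1 -> y%:R <= n%:R * eps ->
  (p * x + (n - p) * y)%N%:R / (n * B)%N%:R <=
    (t * x%:R + (1 - t) * y%:R) / B%:R + eps.
Proof.
move=> B0 n0 pn p1 p2 ye.
have B1 : 1 <= B%:R :> R by rewrite ler1n.
have Bp : 0 < B%:R :> R by rewrite ltr0n.
have np : 0 < n%:R :> R by rewrite ltr0n.
rewrite ler_pdivrMr ?ltr0n ?muln_gt0 ?n0// natrM mulrDl.
rewrite [_ / _ * _]mulrCA mulfVK; last by rewrite gt_eqF.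
rewrite natrD !natrM natrB//.
have x0 : 0 <= x%:R :> R by rewrite ler0n.
have y0 : 0 <= y%:R :> R by rewrite ler0n.
have h1 := ler_wpM2r x0 p1; have h2 := ler_wpM2r y0 p2.
have ne0 : 0 <= n%:R * eps by apply: le_trans ye.
have h3 : n%:R * eps <= n%:R * eps * B%:R by rewrite ler_peMr.
nra.
Qed.

(** Time sharing: about a fraction [t] of [n] copies use the first scheme, the others the second. *)
Lemma achievable_mix (R : realType) (B a b a' b' : nat) (t alpha beta : R) :
  (0 < B)%N -> binary_scheme B a b -> binary_scheme B a' b' -> 0 <= t <= 1 ->
  (t * a%:R + (1 - t) * a'%:R) / B%:R <= alpha ->
  (t * b%:R + (1 - t) * b'%:R) / B%:R <= beta ->
  achievable alpha beta.
Proof.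
move=> B0 s1 s2 /andP[t0 t1] ha hb eps eps0.
(* So large that one extra copy costs at most [n * eps] in both coordinates. *)
pose n := (Num.truncn ((a' + b')%:R / eps)).+1.
have nE : (a' + b')%:R <= n%:R * eps.
  by rewrite -ler_pdivrMr// ltW// real_truncnS_gt// num_real.
pose p := Num.truncn (t * n%:R).
have tn0 : 0 <= t * n%:R by rewrite mulr_ge0.
have /andP[p1 p2] := truncn_itv tn0.
have pn : (p <= n)%N by rewrite -(ler_nat R) (le_trans p1)// ler_piMl.
have s := binary_schemeD (binary_schemeM p s1) (binary_schemeM (n - p) s2).
rewrite -mulnDl subnKC// in s.
have [c] := binary_scheme_code s.
have nB : (0 < n * B)%N by rewrite muln_gt0.
have l2 : ln (2 : R) != 0 by rewrite gt_eqF// ln_gt0// ltr1n.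
have lnE k l : ln (2 ^ k)%N%:R / ln (2 ^ l)%N%:R = k%:R / l%:R :> R.
  rewrite !natrX !lnXn// -[ln _ *+ k]mulr_natl -[ln _ *+ l]mulr_natl.
  by rewrite invfM mulrACA divff// mulr1.
have p2' : t * n%:R <= p%:R + 1 by rewrite natr1 ltW.
exists (2 ^ (n * B))%N, (2 ^ (p * a + (n - p) * a'))%N,
  (2 ^ (p * b + (n - p) * b'))%N, c; split.
- by rewrite -{1}(expn1 2) leq_exp2l.
- by rewrite expn_gt0.
- by rewrite expn_gt0.
- rewrite lnE; apply: le_trans (lerD ha (lexx eps)).
  apply: mix_le => //; apply: le_trans nE.
  by rewrite ler_nat leq_addr.
- rewrite lnE; apply: le_trans (lerD hb (lexx eps)).
  apply: mix_le => //; apply: le_trans nE.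
  by rewrite ler_nat leq_addl.
Qed.

Theorem theorem1 (R : realType) :
  achievable_region R =
  [set p : R * R | [/\ 3 * p.1 >= 1, 2 * p.1 + p.2 >= 1,
                       4 * p.1 + 6 * p.2 >= 3 & 6 * p.2 >= 1]].
Proof.
apply/seteqP; split=> -[x y]; rewrite /achievable_region /=.
  move=> ach.
  have bound := achievable_bound ach.
  have card N Kd K (c : regenerating_code N Kd K) (N0 : (0 < N)%N) :
      (0 < #|'I_N|)%N by rewrite card_ord.
  split.
  - have := bound 1 3 0; rewrite mul0r addr0; apply => N Kd K c N0.
    have := scheme_bound3 R (code_scheme c) (card _ _ _ c N0).
    by rewrite !card_ord mul1r mul0r addr0.
  - have := bound 1 2 1; rewrite mul1r; apply => N Kd K c N0.
    have := scheme_bound21 R (code_scheme c) (card _ _ _ c N0).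
    by rewrite !card_ord !mul1r.
  - apply: bound => N Kd K c N0.
    have := scheme_bound46 R (code_scheme c) (card _ _ _ c N0).
    by rewrite !card_ord.
  - have := bound 1 0 6; rewrite mul0r add0r; apply => N Kd K c N0.
    have := scheme_bound6 R (code_scheme c) (card _ _ _ c N0).
    by rewrite !card_ord mul1r mul0r add0r.
move=> [h1 h2 h3 h4].
(* The factors bring all messages to 24 bits: [(24, 8, 8)], [(24, 9, 6)] and [(24, 12, 4)]. *)
have msr := binary_schemeM 8 msr_scheme.
have mid := binary_schemeM 3 layered_scheme.
have mbr := binary_schemeM 4 mbr_scheme.
have [y3|y3] := leP (1 / 3) y.
  by apply: (achievable_mix _ msr msr (t := 1)); rewrite //= ?ler01 ?lexx//; lra.
have [y4|y4] := leP (1 / 4) y.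
  (* This [t] makes the mixed bandwidth equal [y]; the mixed storage is then [(1 - y) / 2], on the
     edge [2 x + y = 1]. *)
  by apply: (achievable_mix _ msr mid (t := 12 * y - 3)) => //=; lra.
(* Likewise the mixed storage is [(3 - 6 y) / 4], on the edge [4 x + 6 y = 3]. *)
by apply: (achievable_mix _ mid mbr (t := 12 * y - 2)) => //=; lra.
Qed.
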